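(* For all $n \geq 2$, $IC_n = D_{n-1}$, where $IC_n$ is the number of incontractible $n$-cycles in $\mathcal{C}_n$ and $D_m$ is the number of derangements in $S_m$ (permutations without fixed points).
   Context: $\mathcal{C}_n$ is the set of $n$-cycles in the symmetric group $S_n$ (cyclic arrangements of $\{1,\dots,n\}$). An $n$-cycle $C$ is incontractible if there is no $i$ with $1\le i\le n-1$ such that $i+1$ immediately follows $i$ in $C$. *)

(* Defs.v *)
From mathcomp Require Import all_boot all_fingroup.

Set Implicit Arguments.
Unset Strict Implicit.
Unset Printing Implicit Defensive.

(* The paper's ground set {1, .., n} is 'I_n = {0, .., n - 1}, shifted by one.
   In the cyclic arrangement of an n-cycle s, the element that immediately
   follows i is s i. *)

Definition is_full_cycle n (s : 'S_n) : bool := porbits s == [set [set: 'I_n]].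

(* The bound i.+1 < n is the paper's i <= n - 1 after the shift: the last
   element being followed by the first one is not excluded. *)
Definition incontractible n (s : 'S_n) : bool :=
  ~~ [exists i : 'I_n, (i.+1 < n) && (s i == i.+1 :> nat)].

Definition num_incontractible_cycles (n : nat) : nat :=
  #|[set s : 'S_n | is_full_cycle s & incontractible s]|.

Definition derangement m (s : 'S_m) : bool := [forall i, s i != i].

Definition num_derangements (m : nat) : nat :=
  #|[set s : 'S_m | derangement s]|.

(* Main.v *)
Require Import Defs.
From mathcomp Require Import all_boot all_fingroup.
From mathcomp Require Import zify.

Set Implicit Arguments.
Unset Strict Implicit.
Unset Printing Implicit Defensive.

(* For a set A of k positions, both the n-cycles contracting at least at A and
   the permutations of n - 1 points fixing at least A number (n - 1 - k)!.
   Möbius inversion over the sets containing A then equates the numbers of those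
   contracting exactly at A and of those fixing exactly A; take A empty.  The
   n-cycles are counted by growing a cycle on {0, .., k} into one on
   {0, .., k + 1}: k + 1 is inserted just after any point that is not
   prescribed to be followed by another one. *)

(** By downward induction on [A]: a count over supersets is the fibre over [A] plus the fibres over
    proper supersets, which agree by induction and cancel. *)
Lemma eq_card_fiber (U V J : finType) (D : {set U}) (E : {set V})
    (f : U -> {set J}) (g : V -> {set J}) :
  (forall A : {set J}, #|[set u in D | A \subset f u]| =
                       #|[set v in E | A \subset g v]|) ->
  forall A : {set J}, #|[set u in D | f u == A]| = #|[set v in E | g v == A]|.
Proof.
have split_fibers (W : finType) (C : {set W}) (h : W -> {set J}) (A : {set J}) :
    #|[set w in C | A \subset h w]| =
    #|[set w in C | h w == A]| +
    \sum_(B : {set J} | A \proper B) #|[set w in C | h w == B]|.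
  rewrite -sum1dep_card (partition_big h (fun B => A \subset B)) /=; last first.
    by move=> w /andP[].
  rewrite (bigD1 A) //= -sum1dep_card; congr (_ + _).
    apply: eq_bigl => w.
    by case: eqP => [->|]; rewrite ?subxx ?andbT ?andbF.
  apply: eq_big => [B|B /andP[sAB _]].
    by rewrite properEneq andbC eq_sym.
  rewrite -sum1dep_card; apply: eq_bigl => w.
  by case: eqP => [->|]; rewrite ?sAB ?andbT ?andbF.
move=> eq_supersets A; have [c] := ubnP #|~: A|.
elim: c A => // c IHc A ltAc.
have := eq_supersets A; rewrite !split_fibers.
rewrite (eq_bigr (fun B => #|[set v in E | g v == B]|)); first exact: addIn.
move=> B ltAB; apply: IHc; apply: leq_trans (proper_card _) (ltAc : _ <= c).
by rewrite properC ?setCK.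
Qed.

(** Products act from left to right, so [tperm i x * t] sends [i] to [x] and [x] to [t i]: the orbit
    of the fixed point [x] is merged into that of [i]. *)
Lemma card_porbits_insert (T : finType) (t : {perm T}) (i x : T) :
  t x = x -> i != x -> #|porbits t| = #|porbits (tperm i x * t)%g|.+1.
Proof.
move=> tx neq_ix; have := porbits_mul_tperm t i x => /=.
have -> : i \notin porbit t x.
  apply: contra neq_ix => /porbitP[k ->].
  elim: k => [|k IHk]; first by rewrite expg0 perm1.
  by rewrite expgSr permM (eqP IHk) tx.
rewrite neq_ix; lia.
Qed.

Lemma card_porbits1 (T : finType) : #|porbits (1 : {perm T})%g| = #|T|.
Proof.
rewrite card_imset // => x y eq_xy; have: x \in porbit 1 y by rewrite -eq_xy porbit_id.
by case/porbitP=> k ->; rewrite expg1n perm1.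
Qed.

Lemma card_porbits_eq1 (T : finType) (s : {perm T}) :
  0 < #|T| -> (porbits s == [set [set: T]]) = (#|porbits s| == 1).
Proof.
case/card_gt0P=> x0 _; apply/eqP/idP => [->|/cards1P[X defX]].
  by rewrite cards1.
have porbitX x : porbit s x = X by apply/set1P; rewrite -defX imset_f.
rewrite defX; congr [set _]; apply/setP=> x.
by rewrite inE -(porbitX x) porbit_id.
Qed.

Section PrefixCycles.

Variable m : nat.
Implicit Types (A : {set 'I_m.+1}) (s t : 'S_m.+1) (i j x : 'I_m.+1).

Definition prefix k : {set 'I_m.+1} := [set i : 'I_m.+1 | i <= k].

Definition contracts_on A s : bool := [forall i in A, s i == i.+1 :> nat].

(* Given the support condition, having m.+1 - k orbits means that s is a single
   cycle on {0, .., k}. *)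
Definition prefix_cycles k A : {set 'S_m.+1} :=
  [set s | [&& perm_on (prefix k) s, #|porbits s| + k == m.+1
             & contracts_on A s]].

Lemma perm_on_prefixP k s :
  reflect (forall i, k < i -> s i = i) (perm_on (prefix k) s).
Proof.
apply: (iffP idP) => [on_s i lt_ki|fix_s].
  by apply: out_perm on_s _; rewrite inE -ltnNge.
apply/subsetP=> i; rewrite !inE; apply: contraR; rewrite -ltnNge => /fix_s->.
exact: eqxx.
Qed.

Lemma perm_on_prefix_pred k x s :
  x = k.+1 :> nat -> perm_on (prefix k.+1) s -> s x = x ->
  perm_on (prefix k) s.
Proof.
move=> def_x /perm_on_prefixP on_s sx; apply/perm_on_prefixP=> i lt_ki.
have [->//|neq_ix] := eqVneq i x; apply: on_s.
by rewrite ltn_neqAle lt_ki andbT -def_x eq_sym.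
Qed.

Lemma perm_on_prefix0 s : perm_on (prefix 0) s -> s = 1%g.
Proof.
move=> on_s; apply: (perm_on_id on_s); rewrite -(cards1 (ord0 : 'I_m.+1)).
by apply/subset_leq_card/subsetP=> i; rewrite !inE leqn0 -val_eqE.
Qed.

(** Inverse of the insertion: the predecessor of [x] is sent to [s x], and [x] becomes a fixed
    point. *)
Lemma perm_on_prefix_cut k x s :
  x = k.+1 :> nat -> perm_on (prefix k.+1) s ->
  perm_on (prefix k) (tperm (s^-1 x) x * s)%g.
Proof.
move=> def_x on_s; apply: (@perm_on_prefix_pred k x) => //; last first.
  by rewrite permM tpermR permKV.
apply: perm_onM => //; apply: subset_trans (tperm_on _ _) _.
have x_in : x \in prefix k.+1 by rewrite inE def_x.
apply/subsetP=> i /set2P[]->//.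
by rewrite (perm_closed _ (perm_onV on_s)).
Qed.

(** Each of the [m - k] points above [k] is an orbit, and the prefix contributes at least one more.
    This bound serves to show that the top point of a prefix cycle is not fixed. *)
Lemma card_porbits_prefix k s :
  k <= m -> perm_on (prefix k) s -> m < #|porbits s| + k.
Proof.
elim: k s => [|k IHk] s le_km on_s.
  by rewrite (perm_on_prefix0 on_s) card_porbits1 card_ord addn0.
pose x : 'I_m.+1 := Ordinal (le_km : k.+1 < m.+1).
have def_x : x = k.+1 :> nat by [].
have [sx|neq_sx] := eqVneq (s x) x.
  have := IHk s (ltnW le_km) (perm_on_prefix_pred def_x on_s sx); lia.
have := IHk _ (ltnW le_km) (perm_on_prefix_cut def_x on_s).
rewrite (@card_porbits_insert _ _ (s^-1 x)%g x).
- by rewrite mulgA tperm2 mul1g; lia.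
- by rewrite permM tpermR permKV.
by apply: contraNneq neq_sx => eq_x; rewrite -{1}eq_x permKV.
Qed.

(* x goes right after i: a prescribed contraction at k forces i = k, and any
   other prescribed contraction must not be broken. *)
Lemma prefix_cycles_insert k x A :
  x = k.+1 :> nat -> (forall i, i \in A -> i <= k) ->
  prefix_cycles k.+1 A =
  [set (tperm i x * t)%g
    | i in [set i in prefix k | [forall j in A, (i == j) == (j == k :> nat)]],
      t in prefix_cycles k [set j in A | j != k :> nat]].
Proof.
move=> def_x leAk; apply/setP=> s; rewrite inE; apply/and3P/imset2P.
  case=> on_s card_s /forall_inP As; pose i := (s^-1 x)%g.
  have le_km : k <= m by move: (ltn_ord x); lia.
  have si : s i = x by rewrite permKV.
  (* If [x] were fixed, [s] would live on [prefix k] with one orbit too few. *)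
  have neq_ix : i != x.
    apply: contraTneq card_s => eq_ix; have sx : s x = x by rewrite -{1}eq_ix.
    have := card_porbits_prefix le_km (perm_on_prefix_pred def_x on_s sx); lia.
  (* By injectivity of [s], [i = j] means [x = s j], that is, [k + 1 = j + 1]. *)
  have eq_i j : j \in A -> (i == j) = (j == k :> nat).
    move=> Aj; rewrite -(inj_eq (@perm_inj _ s)) si eq_sym -val_eqE /=.
    by rewrite (eqP (As j Aj)) def_x eqSS.
  exists i (tperm i x * s)%g; last by rewrite mulgA tperm2 mul1g.
    rewrite !inE; apply/andP; split; last by apply/forall_inP=> j Aj; rewrite eq_i.
    have : i \in prefix k.+1 by rewrite (perm_closed _ (perm_onV on_s)) inE def_x.
    by move: neq_ix; rewrite inE -val_eqE /= def_x; lia.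
  rewrite inE; apply/and3P; split; first exact: perm_on_prefix_cut.
    move: card_s; rewrite (@card_porbits_insert _ (tperm i x * s)%g i x) //.
      by rewrite mulgA tperm2 mul1g; lia.
    by rewrite permM tpermR.
  apply/forall_inP=> j /[!inE] /andP[Aj neq_jk].
  rewrite permM tpermD ?As ?eq_i // -val_eqE /= def_x.
  by have := leAk j Aj; lia.
case=> i t /[!inE] /andP[le_ik /forall_inP eq_i] /and3P[on_t card_t /forall_inP At] ->.
have tx : t x = x by apply: (perm_on_prefixP _ _ on_t); rewrite def_x.
have neq_ix : i != x by rewrite -val_eqE /= def_x; lia.
split.
- apply/perm_on_prefixP=> j lt_kj.
  rewrite permM tpermD -?val_eqE /= ?def_x; [|lia..].
  by apply: (perm_on_prefixP _ _ on_t); apply: ltnW.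
- by rewrite addnS -addSn -(card_porbits_insert tx neq_ix).
apply/forall_inP=> j Aj; rewrite permM.
have [eq_jk|neq_jk] := eqVneq (j : nat) k.
  have /eqP-> : i == j by rewrite (eqP (eq_i j Aj)) eq_jk.
  by rewrite tpermL tx def_x eq_jk.
rewrite tpermD; first by apply: At; rewrite inE Aj.
  by rewrite (eqP (eq_i j Aj)).
by rewrite -val_eqE /= def_x; have := leAk j Aj; lia.
Qed.

(** In the inductive step, if [k] is in [A], the predecessor of [k + 1] is forced and [A] loses a
    point; otherwise there are [k + 1 - #|A|] choices for it, the new factor of the factorial. *)
Lemma card_prefix_cycles k A :
  k <= m -> (forall i, i \in A -> i < k) -> #|prefix_cycles k A| = (k - #|A|)`!.
Proof.
elim: k A => [|k IHk] A le_km ltAk.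
  have -> : A = set0 by apply/setP=> i; rewrite inE; apply/negP => /ltAk.
  rewrite cards0 subnn fact0; apply/eqP/cards1P; exists 1%g; apply/setP=> s.
  rewrite !inE; apply/and3P/eqP=> [[/perm_on_prefix0]//|->].
  split; first exact: perm_on1.
    by rewrite card_porbits1 card_ord addn0.
  by apply/forall_inP=> i; rewrite inE.
pose x : 'I_m.+1 := Ordinal (le_km : k.+1 < m.+1).
pose y : 'I_m.+1 := Ordinal (ltnW (le_km : k.+1 < m.+1)).
have def_x : x = k.+1 :> nat by [].
have def_A : [set j in A | j != k :> nat] = A :\ y.
  by apply/setP=> j; rewrite !inE andbC -val_eqE.
rewrite (prefix_cycles_insert def_x ltAk) def_A curry_imset2X card_in_imset; last first.
  have tx t : t \in prefix_cycles k (A :\ y) -> t x = x.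
    by rewrite inE => /and3P[/perm_on_prefixP on_t _ _]; apply: on_t.
  move=> [i t] [j u] /setXP[_ /tx tx1] /setXP[_ /tx tx2] /= eq_tu.
  (* The insertion point can be read off the product as the preimage of [x], since [t] and [u] both
     fix [x]. *)
  have eq_ij : i = j.
    apply: (@perm_inj _ (tperm j x)); rewrite tpermL; apply: (@perm_inj _ u).
    by rewrite -permM -eq_tu permM tpermL tx1 tx2.
  by move: eq_tu; rewrite eq_ij => /mulgI->.
rewrite cardsX IHk ?(ltnW le_km) //; last first.
  move=> i; rewrite !inE -val_eqE /= => /andP[neq_ik /ltAk]; lia.
have [Ay|nAy] := boolP (y \in A).
  rewrite (_ : [set i in _ | _] = [set y]) ?cards1 ?mul1n.
    by rewrite [#|A|](cardsD1 y) Ay add1n subSS.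
  apply/setP=> i; rewrite !inE; apply/andP/eqP => [[_ /forall_inP/(_ y Ay)]|->].
    by rewrite eqxx => /eqP/eqP.
  split; first exact: leqnn.
  by apply/forall_inP=> j Aj; rewrite (eq_sym y) -val_eqE.
have sAk : A \subset prefix k by apply/subsetP=> i /ltAk; rewrite inE.
have card_k : #|prefix k| = k.+1.
  by rewrite -sum1dep_card (big_ord_narrow_leq (ltnW le_km)) sum1_card card_ord.
(* Because [A] avoids [y], the truncated subtraction [k - #|A|] is exact, as [subSn] requires
   below. *)
have leAk : #|A| <= k.
  have <- : #|prefix k :\ y| = k.
    by apply: succn_inj; rewrite -card_k (cardsD1 y (prefix k)) inE leqnn.
  by apply: subset_leq_card; rewrite subsetD1 sAk.
rewrite (_ : [set i in _ | _] = prefix k :\: A).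
  have -> : A :\ y = A by apply/setDidPl; rewrite disjoint_sym disjoints1.
  rewrite cardsD (setIidPr sAk) card_k.
  by rewrite subSn // factS.
apply/setP=> i; rewrite !inE andbC; congr (_ && _).
apply/forall_inP/idP=> [eq_i|nAi j Aj].
  apply: contra nAy => Ai; have := eq_i i Ai; rewrite eqxx eq_sym => /eqP/eqP eq_ik.
  by have <- : i = y by exact: val_inj.
have -> : (j == k :> nat) = (j == y) by [].
have [eq_ij|_] := eqVneq i j; first by rewrite eq_ij Aj in nAi.
by have [eq_jy|//] := eqVneq j y; rewrite -eq_jy Aj in nAy.
Qed.

(** The index type ['I_m] leaves out the last point and matches that of the fixed points of a
    permutation in ['S_m]. *)
Definition contractions s : {set 'I_m} :=
  [set i : 'I_m | s (widen_ord (leqnSn m) i) == i.+1 :> nat].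

(** This is [card_prefix_cycles] at [k = m], where the prefix is the whole ground set and the orbit
    condition asks for one orbit. *)
Lemma card_cycles_contracting (B : {set 'I_m}) :
  #|[set s in [set s | is_full_cycle s] | B \subset contractions s]| =
  (m - #|B|)`!.
Proof.
pose A := [set widen_ord (leqnSn m) i | i in B].
have card_A : #|A| = #|B|.
  by apply: card_imset => i j /(congr1 val) /= /val_inj.
rewrite -card_A -(@card_prefix_cycles m) //; last first.
  by move=> _ /imsetP[i _ ->] /=.
apply: eq_card => s; rewrite !inE; have -> : perm_on (prefix m) s.
  by apply/perm_on_prefixP=> i lt_mi; have := ltn_ord i; lia.
rewrite /is_full_cycle card_porbits_eq1 ?card_ord //=.
rewrite -(eqn_add2r m) add1n; congr (_ && _).
apply/subsetP/forall_inP=> [sB _ /imsetP[i /sB + ->]|As i Bi].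
  by rewrite inE.
by rewrite inE; apply: (As (widen_ord _ i)); apply: imset_f.
Qed.

End PrefixCycles.

Definition fixed_points m (t : 'S_m) : {set 'I_m} := [set i | t i == i].

(** Fixing [B] pointwise amounts to being supported on its complement. *)
Lemma card_perms_fixing m (B : {set 'I_m}) :
  #|[set t in [set: 'S_m] | B \subset fixed_points t]| = (m - #|B|)`!.
Proof.
have -> : m - #|B| = #|~: B| by rewrite [RHS]cardsCs setCK card_ord.
rewrite -card_perm; apply: eq_card => t; rewrite !inE.
apply/subsetP/subsetP=> [fixB i|on_t i Bi].
  by rewrite !inE; apply: contraNN => /fixB; rewrite inE.
by rewrite inE; apply: contraLR Bi => /on_t; rewrite inE.
Qed.

Theorem corollary6 (n : nat) (hn : 2 <= n) :
  num_incontractible_cycles n = num_derangements n.-1.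
Proof.
case: n hn => // m _ /=.
rewrite /num_incontractible_cycles /num_derangements.
transitivity #|[set s : 'S_m.+1 in [set s | is_full_cycle s]
                 | contractions s == set0]|.
  apply: eq_card => s; rewrite !inE; congr (_ && _).
  apply/existsPn/eqP => [no_c|c0 i].
    apply/setP=> i; rewrite !inE; apply: negbTE.
    by have := no_c (widen_ord (leqnSn m) i); rewrite /= ltnS ltn_ord.
  apply/negP=> /andP[lt_im si]; have := in_set0 (Ordinal (lt_im : i < m)).
  rewrite -c0 inE => /negP[]; congr (nat_of_ord (s _) == _): si.
  exact: val_inj.
rewrite (eq_card_fiber (E := setT) (g := @fixed_points m)) => [|B]; last first.
  by rewrite card_cycles_contracting card_perms_fixing.
apply: eq_card => t; rewrite !inE /=; apply/eqP/forallP => [f0 i|no_f].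
  by have := in_set0 i; rewrite -f0 inE => ->.
by apply/setP=> i; rewrite !inE (negPf (no_f i)).
Qed.
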